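(* Let $\vec b=(b_0,b_1,\dots)$ be an infinite sequence of integers and let $n\ge2$. Then $\widehat{C}^{\vec b}_{3,4,n}=(b_0+3b_2)\,\widehat{C}^{\vec b}_{3,4,n-1}+b_0b_2\,\widehat{C}^{\vec b}_{3,4,n-2}$.
   Context: A $k$-dimensional balanced ballot path of length $kn$ is a sequence of $kn$ standard unit vectors of $\mathbb{R}^k$, each $\vec e_i$ occurring exactly $n$ times, such that every intermediate point (partial sum, including the origin) $\vec x=(x_1,\dots,x_k)$ satisfies $x_1\ge\cdots\ge x_k$. The semisymmetric height of $\vec x$ is $g_k(\vec x)=\sum_{i=1}^k(k+1-2i)x_i$ (so $g_3(\vec x)=2x_1-2x_3$) and the semisymmetric height $g_k(P)$ of a path is the maximum of $g_k$ over its intermediate points (the empty path has height $0$). Steps $\vec e_i$ with $i\le\lfloor k/2\rfloor$ are semisymmetric up-steps. For a sequence $\vec b$, the weight $sswt_{\vec b}(P)$ is the product, over all up-steps of $P$, of $b_h$ where $h$ is the semisymmetric height of the starting point of that up-step (the empty path has weight $1$). Define $\widehat{C}^{\vec b}_{k,u,n}=\sum_P sswt_{\vec b}(P)$, summed over all $k$-dimensional balanced ballot paths of length $kn$ with $g_k(P)\le u$. *)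

(* Defs.v *)
From mathcomp Require Import all_boot all_order all_algebra.

Set Implicit Arguments.
Unset Strict Implicit.
Unset Printing Implicit Defensive.

Import Order.TTheory GRing.Theory Num.Theory.
Local Open Scope ring_scope.

(* A path is the sequence of indices of its unit steps. Indices are 0-based:
   the step [i : 'I_k] stands for the unit vector e_(i+1) of R^k.             *)

Definition endpoint (k : nat) (s : seq 'I_k) : 'rV[int]_k :=
  \sum_(i <- s) delta_mx 0 i.

Definition point (k : nat) (s : seq 'I_k) (m : nat) : 'rV[int]_k :=
  endpoint (take m s).

Definition ballot_point (k : nat) (x : 'rV[int]_k) : bool :=
  [forall i : 'I_k, forall j : 'I_k, (i <= j)%N ==> (x 0 j <= x 0 i)].

Definition balanced_ballot_path (k n : nat) (P : (k * n).-tuple 'I_k) : bool :=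
  [forall i : 'I_k, count_mem i P == n] &&
  [forall m : 'I_(k * n).+1, ballot_point (point P m)].

Definition ssheight (k : nat) (x : 'rV[int]_k) : int :=
  \sum_(i < k) (k%:Z + 1 - 2 * i.+1%:Z) * x 0 i.

(* The default value 0 of the iterated maximum is the height of the origin,
   which is an intermediate point of every path.                              *)
Definition path_ssheight (k : nat) (s : seq 'I_k) : int :=
  \big[Num.max/0]_(m < (size s).+1) ssheight (point s m).

Definition ss_up_step (k : nat) (i : 'I_k) : bool := (i < k./2)%N.

(* [ssheight] is nonnegative at ballot points, so the absolute value only
   converts the height from [int] to [nat].                                   *)
Definition sswt (b : nat -> int) (k N : nat) (P : N.-tuple 'I_k) : int :=
  \prod_(m < N | ss_up_step (tnth P m)) b `|ssheight (point P m)|%N.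

Definition Chat (b : nat -> int) (k u n : nat) : int :=
  \sum_(P : (k * n).-tuple 'I_k |
          balanced_ballot_path P && (path_ssheight P <= u%:Z)) sswt b P.

(* Main.v *)
Require Import Defs.
From mathcomp Require Import all_boot all_order all_algebra.
From mathcomp Require Import zify ring.

Set Implicit Arguments.
Unset Strict Implicit.
Unset Printing Implicit Defensive.

Import Order.TTheory GRing.Theory Num.Theory.
Local Open Scope ring_scope.

(* Transfer matrix: in dimension 3 a path is determined by the gaps
   p = x_1 - x_2 and q = x_2 - x_3, its height is 2 (p + q), and the bound 4
   leaves the six states p, q >= 0, p + q <= 2.  As p + 2 q grows by 1 modulo 3
   at every step, three consecutive steps act on the states (0,0) and (1,1)
   alone, by the matrix
     [ b_0   2 b_0 b_2 ]
     [ 2     3 b_2     ]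
   of trace b_0 + 3 b_2 and determinant - b_0 b_2.  The recurrence is its
   characteristic equation. *)

Definition bounded_ballot_point (k u : nat) (x : 'rV[int]_k) : bool :=
  ballot_point x && (ssheight x <= u%:Z).

(** Start and target are arbitrary because deleting the first step of a balanced path leaves a path
    that no longer starts at the origin; the recursion on the first step needs this generality. *)
Definition bounded_path_from (k u N : nat) (x y : 'rV[int]_k)
    (P : N.-tuple 'I_k) : bool :=
  (x + endpoint P == y) &&
  [forall m : 'I_N.+1, bounded_ballot_point u (x + point P m)].

Definition path_weight_from (b : nat -> int) (k N : nat) (x : 'rV[int]_k)
    (P : N.-tuple 'I_k) : int :=
  \prod_(m < N | ss_up_step (tnth P m)) b `|ssheight (x + point P m)|%N.

Definition path_sum (b : nat -> int) (k u N : nat) (x y : 'rV[int]_k) : int :=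
  \sum_(P : N.-tuple 'I_k | bounded_path_from u x y P) path_weight_from b x P.

Lemma big_tupleS (R : Type) (idx : R) (op : Monoid.com_law idx) (T : finType)
    (N : nat) (p : pred (N.+1.-tuple T)) (F : N.+1.-tuple T -> R) :
  \big[op/idx]_(P | p P) F P =
  \big[op/idx]_(i : T) \big[op/idx]_(t : N.-tuple T | p [tuple of i :: t])
     F [tuple of i :: t].
Proof.
rewrite pair_big_dep /=.
rewrite (reindex (fun c : T * N.-tuple T => [tuple of c.1 :: c.2])) //=.
exists (fun t : N.+1.-tuple T => (thead t, [tuple of behead t])) => [[i t] _|t _] /=.
  by congr pair; apply: val_inj.
by rewrite [RHS]tuple_eta; apply: val_inj.
Qed.

Lemma endpoint_cons (k : nat) (i : 'I_k) (s : seq 'I_k) :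
  endpoint (i :: s) = delta_mx 0 i + endpoint s.
Proof. exact: big_cons. Qed.

Lemma endpoint_nil (k : nat) : endpoint [::] = 0 :> 'rV[int]_k.
Proof. exact: big_nil. Qed.

Lemma endpoint_coord (k : nat) (s : seq 'I_k) (i : 'I_k) :
  endpoint s 0 i = (count_mem i s)%:Z.
Proof.
elim: s => [|j s IHs]; first by rewrite endpoint_nil mxE.
by rewrite endpoint_cons !mxE IHs /= PoszD [i == j]eq_sym natz.
Qed.

Lemma point0 (k : nat) (s : seq 'I_k) : point s 0 = 0.
Proof. by rewrite /point take0 endpoint_nil. Qed.

Lemma point_cons (k : nat) (i : 'I_k) (s : seq 'I_k) (m : nat) :
  point (i :: s) m.+1 = delta_mx 0 i + point s m.
Proof. exact: endpoint_cons. Qed.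

Lemma bounded_path_from_cons (k u N : nat) (x y : 'rV[int]_k) (i : 'I_k)
    (t : N.-tuple 'I_k) :
  bounded_path_from u x y [tuple of i :: t] =
  bounded_ballot_point u x && bounded_path_from u (x + delta_mx 0 i) y t.
Proof.
rewrite /bounded_path_from /= endpoint_cons addrA andbCA; congr andb.
apply/forallP/andP => [Hall|[Hx /forallP Hall] m].
  split; first by have := Hall ord0; rewrite point0 addr0.
  by apply/forallP => m; have := Hall (lift ord0 m); rewrite point_cons addrA.
have [j ->|->] := unliftP ord0 m; last by rewrite point0 addr0.
by rewrite point_cons addrA.
Qed.

Lemma path_weight_from_cons (b : nat -> int) (k N : nat) (x : 'rV[int]_k)
    (i : 'I_k) (t : N.-tuple 'I_k) :
  path_weight_from b x [tuple of i :: t] =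
  (if ss_up_step i then b `|ssheight x|%N else 1) *
  path_weight_from b (x + delta_mx 0 i) t.
Proof.
rewrite /path_weight_from big_mkcond big_ord_recl /= point0 addr0 tnth0.
congr (_ * _); rewrite [RHS]big_mkcond; apply: eq_bigr => m _.
by rewrite tnthS point_cons addrA.
Qed.

Lemma path_sum0 (b : nat -> int) (k u : nat) (x y : 'rV[int]_k) :
  path_sum b u 0 x y = (bounded_ballot_point u x && (x == y))%:R.
Proof.
rewrite /path_sum big_mkcond (big_pred1 [tuple]) => [|t]; last first.
  by apply/esym/eqP; rewrite tuple0.
rewrite /path_weight_from big_ord0 /bounded_path_from endpoint_nil addr0 andbC.
have -> : [forall m : 'I_1, bounded_ballot_point u (x + point [tuple] m)] =
          bounded_ballot_point u x.
  apply/forallP/idP => [/(_ ord0)|Hx m]; first by rewrite point0 addr0.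
  by rewrite ord1 point0 addr0.
by case: ifP.
Qed.

Lemma path_sumS (b : nat -> int) (k u N : nat) (x y : 'rV[int]_k) :
  path_sum b u N.+1 x y =
  if bounded_ballot_point u x then
    \sum_(i < k) (if ss_up_step i then b `|ssheight x|%N else 1) *
                 path_sum b u N (x + delta_mx 0 i) y
  else 0.
Proof.
rewrite /path_sum big_tupleS; case: ifP => Hx; last first.
  rewrite big1 // => i _; rewrite big_pred0 // => t.
  by rewrite bounded_path_from_cons Hx.
apply: eq_bigr => i _; rewrite big_distrr /=; apply: eq_big => t.
  by rewrite bounded_path_from_cons Hx.
by rewrite path_weight_from_cons.
Qed.

(** Having each letter [n] times amounts to ending at [(n, ..., n)], and a bound on the maximal
    height is a bound at every intermediate point. The default value 0 of the maximum is harmless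
    since [0 <= u]. *)
Lemma Chat_path_sum (b : nat -> int) (k u n : nat) :
  Chat b k u n = path_sum b u (k * n) (0 : 'rV_k) (const_mx n%:Z).
Proof.
apply: eq_big => [P|P _]; last first.
  by apply: eq_bigr => m _; rewrite add0r.
rewrite /balanced_ballot_path /bounded_path_from add0r -andbA; congr andb.
  apply/forallP/eqP => [Hc|Hc i].
    by apply/rowP => i; rewrite endpoint_coord mxE (eqP (Hc i)).
  by rewrite -eqz_nat -endpoint_coord Hc mxE.
rewrite /path_ssheight size_tuple.
apply/andP/forallP => [[/forallP Hb /bigmax_leP[_ Hh]] m|Hm].
  by rewrite /bounded_ballot_point add0r Hb Hh.
split; first by apply/forallP => m; have /andP[] := Hm m; rewrite add0r.
by apply/bigmax_leP; split=> // m _; have /andP[_] := Hm m; rewrite add0r.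
Qed.

Definition bounded_gaps (p q : int) : bool :=
  [&& 0 <= p, 0 <= q & p + q <= 2].

(** The three summands are the steps e_1, e_2, e_3; for k = 3 only e_1 is an up-step and carries a
    weight. The value 0 outside the six states discards paths that break the ballot condition or the
    height bound. *)
Fixpoint gap_sum (b : nat -> int) (N : nat) (p q : int) : int :=
  if bounded_gaps p q then
    if N is N'.+1 then
      b `|(2 * (p + q))%R|%N * gap_sum b N' (p + 1) q
      + gap_sum b N' (p - 1) (q + 1) + gap_sum b N' p (q - 1)
    else ((p == 0) && (q == 0))%:R
  else 0.

(** Written as iterated lifts, the indices have the shape that [big_ord_recl] produces. *)
Local Notation i0 := (ord0 : 'I_3).
Local Notation i1 := (lift ord0 ord0 : 'I_3).
Local Notation i2 := (lift ord0 (lift ord0 ord0) : 'I_3).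

Lemma ord3_cases (i : 'I_3) : [\/ i = i0, i = i1 | i = i2].
Proof.
case: i => [[|[|[|m]]] Hm] //; [apply: Or31|apply: Or32|apply: Or33];
  exact: val_inj.
Qed.

Lemma ssheight3 (x : 'rV[int]_3) : ssheight x = 2 * (x 0 i0 - x 0 i2).
Proof.
rewrite /ssheight !big_ord_recl big_ord0 /=.
by rewrite /bump /=; lia.
Qed.

Lemma bounded_ballot_point3 (x : 'rV[int]_3) :
  bounded_ballot_point 4 x = bounded_gaps (x 0 i0 - x 0 i1) (x 0 i1 - x 0 i2).
Proof.
rewrite /bounded_ballot_point /bounded_gaps ssheight3.
have -> : ballot_point x = (x 0 i1 <= x 0 i0) && (x 0 i2 <= x 0 i1).
  apply/forallP/andP => [Hx|[H1 H2] i].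
    by split; [move/forallP/(_ i1): (Hx i0)|move/forallP/(_ i2): (Hx i1)].
  apply/forallP => j; apply/implyP.
  by case: (ord3_cases i) => ->; case: (ord3_cases j) => -> //= _;
    apply: le_trans H1.
by lia.
Qed.

(** Gaps forget translations along (1,1,1). The hypothesis on the coordinate sum restores this
    information: when no step remains, zero gaps force all coordinates to be [n]. Each step raises
    the sum by 1, so the hypothesis is preserved. *)
Lemma path_sum_gap_sum (b : nat -> int) (n N : nat) (x : 'rV[int]_3) :
  x 0 i0 + x 0 i1 + x 0 i2 + N%:Z = 3 * n%:Z ->
  path_sum b 4 N x (const_mx n%:Z) =
  gap_sum b N (x 0 i0 - x 0 i1) (x 0 i1 - x 0 i2).
Proof.
elim: N x => [|N IHN] x Hx.
  rewrite path_sum0 bounded_ballot_point3 /=; case: ifP => //= _.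
  congr (nat_of_bool _)%:R; apply/eqP/andP => [->|[/eqP H1 /eqP H2]].
    by rewrite !mxE subrr.
  apply/rowP => i; rewrite mxE.
  by case: (ord3_cases i) => -> /=; lia.
rewrite path_sumS bounded_ballot_point3 /=; case: ifP => // _.
rewrite !big_ord_recl big_ord0 addr0 /= !mul1r.
rewrite !IHN ?mxE /=; try lia.
rewrite ssheight3 addrA.
have -> : x 0 i0 - x 0 i1 + (x 0 i1 - x 0 i2) = x 0 i0 - x 0 i2 by ring.
congr (_ * gap_sum _ _ _ _ + gap_sum _ _ _ _ + gap_sum _ _ _ _); lia.
Qed.

Lemma gap_sum_step3 (b : nat -> int) (N : nat) :
  gap_sum b N.+3 0 0 =
    b 0%N * gap_sum b N 0 0 + 2 * b 0%N * b 2%N * gap_sum b N 1 1 /\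
  gap_sum b N.+3 1 1 = 2 * gap_sum b N 0 0 + 3 * b 2%N * gap_sum b N 1 1.
Proof.
have S (p q : int) M : gap_sum b M.+1 p q = if bounded_gaps p q then
      b `|(2 * (p + q))%R|%N * gap_sum b M (p + 1) q
      + gap_sum b M (p - 1) (q + 1) + gap_sum b M p (q - 1) else 0 by [].
have Z (p q : int) M : ~~ bounded_gaps p q -> gap_sum b M p q = 0.
  by case: M => [|M] /= /negbTE ->.
(* One equation per state, with [Z] removing the moves that leave the region. At the three states of
   height 4 the removed moves include the up-step, so [b 4] never occurs. *)
have E00 M : gap_sum b M.+1 0 0 = b 0%N * gap_sum b M 1 0.
  by rewrite S /= (Z (0 - 1)) // (Z _ (0 - 1)) // !addr0.
have E10 M : gap_sum b M.+1 1 0 = b 2%N * gap_sum b M 2 0 + gap_sum b M 0 1.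
  by rewrite S /= (Z _ (0 - 1)) // addr0.
have E01 M : gap_sum b M.+1 0 1 = b 2%N * gap_sum b M 1 1 + gap_sum b M 0 0.
  by rewrite S /= (Z (0 - 1)) // addr0.
have E20 M : gap_sum b M.+1 2 0 = gap_sum b M 1 1.
  by rewrite S /= (Z (2 + 1)) // (Z _ (0 - 1)) // mulr0 add0r addr0.
have E11 M : gap_sum b M.+1 1 1 = gap_sum b M 0 2 + gap_sum b M 1 0.
  by rewrite S /= (Z (1 + 1)) // mulr0 add0r.
have E02 M : gap_sum b M.+1 0 2 = gap_sum b M 0 1.
  by rewrite S /= (Z (0 + 1)) // (Z (0 - 1)) // mulr0 !add0r.
(* Rewriting stops after three steps, at length [N], where only the states (0,0) and (1,1)
   remain. *)
by split; rewrite ?(E00, E10, E01, E20, E11, E02); ring.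
Qed.

Lemma Chat3_gap_sum (b : nat -> int) (n : nat) :
  Chat b 3 4 n = gap_sum b (3 * n) 0 0.
Proof. by rewrite Chat_path_sum path_sum_gap_sum !mxE ?subrr //; lia. Qed.

Theorem theorem4p2 (b : nat -> int) (n : nat) (hn : (2 <= n)%N) :
  Chat b 3 4 n =
    (b 0%N + 3 * b 2%N) * Chat b 3 4 (n - 1) + b 0%N * b 2%N * Chat b 3 4 (n - 2).
Proof.
case: n hn => [|[|n]] // _; rewrite !Chat3_gap_sum subn1 subn2 ![_.-1]/=.
rewrite !mulnS !add3n.
have [E00 E11] := gap_sum_step3 b (3 * n).
(* Only the first row of the matrix is needed at the upper level. Once everything is expressed
   through the values at (0,0) and (1,1) for length [3 * n], the terms in the latter cancel, as the
   characteristic equation predicts. *)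
by rewrite (gap_sum_step3 b (3 * n).+3).1 E11 E00; ring.
Qed.
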